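(* There is an absolute constant $c>0$ such that the following holds. Let $G$ be any graph with treewidth $w$ and maximum degree $d \ge 1$. Then every MWIS-circuit of $G$ has at least $2^{c\,w/d}$ gates.
   Context: A tropical circuit over a set of variables $X$ is a finite directed acyclic graph whose vertices (gates) have in-degree $0$ or $2$; each in-degree-$0$ gate is labeled by a variable of $X$ or by the constant $0$, each in-degree-$2$ gate is labeled by $\max$ or $+$, and one gate is designated the output gate. It computes, over the tropical semiring $(\mathbb{R}\cup\{-\infty\},\max,+)$ (where $\max$ acts as addition and $+$ as multiplication, with unit $0$), a tropical polynomial: formally each gate computes a set of monomials (finite multisets of variables): a leaf labeled $x$ computes $\{x\}$, a leaf labeled $0$ computes the empty monomial, a $\max$ gate computes the union of its children's monomial sets, and a $+$ gate computes all products (multiset unions) of a monomial of one child with a monomial of the other. For a graph $G$, an MWIS-polynomial of $G$ is a tropical polynomial $f$ in the variables $V(G)$ such that (1) every monomial of $f$ is of the form $v_1\cdots v_l$ with $\{v_1,\dots,v_l\}$ an independent set of $G$ (distinct vertices), and (2) for every independent set $\{v_1,\dots,v_l\}$ of $G$, including the empty set (the empty monomial), the monomial $v_1\cdots v_l$ occurs in $f$. An MWIS-circuit of $G$ is a tropical circuit over $V(G)$ computing an MWIS-polynomial of $G$ (equivalently, it outputs the weight of a maximum weight independent set of $G$ for every real weight assignment to the vertices). *)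

(* Defs.v *)
From HB Require Import structures.
From mathcomp Require Import all_boot.
From mathcomp Require Import finmap multiset.

Set Implicit Arguments.
Unset Strict Implicit.
Unset Printing Implicit Defensive.

Local Open Scope nat_scope.
Local Open Scope mset_scope.

Record sgraph := SGraph {
  vertex :> finType;
  adj : rel vertex;
  adj_sym : symmetric adj;
  adj_irrefl : irreflexive adj
}.

Definition degree (G : sgraph) (v : G) : nat := #|[set u | adj v u]|.

Definition max_degree (G : sgraph) : nat := \max_(v : G) degree v.

Definition independent (G : sgraph) (S : {set G}) : Prop :=
  forall u v, u \in S -> v \in S -> ~~ adj u v.

(* A cycle of a simple graph has at least three vertices; [ucycle] also
   accepts the degenerate cycle [:: x; y] traversing an edge back and forth. *)
Definition is_tree (T : sgraph) : Prop :=
  [/\ 0 < #|T|,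
      forall s t : T, connect (@adj T) s t
    & forall c : seq T, ucycle (@adj T) c -> size c <= 2].

Record tree_decomposition (G : sgraph) := TreeDecomposition {
  td_tree : sgraph;
  td_bag : td_tree -> {set G};
  td_is_tree : is_tree td_tree;
  td_vertex : forall v : G, exists t, v \in td_bag t;
  td_edge : forall u v : G, adj u v ->
    exists t, (u \in td_bag t) && (v \in td_bag t);
  td_connected : forall (v : G) (s t : td_tree),
    v \in td_bag s -> v \in td_bag t ->
    connect [rel a b | [&& adj a b, v \in td_bag a & v \in td_bag b]] s t
}.

(* Predecessor is truncated: the vertexless graph gets width 0, not -1. *)
Definition td_width (G : sgraph) (D : tree_decomposition G) : nat :=
  (\max_(t : td_tree D) #|td_bag t|).-1.

Definition is_treewidth (G : sgraph) (w : nat) : Prop :=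
  (exists D : tree_decomposition G, td_width D = w) /\
  (forall D : tree_decomposition G, w <= td_width D).

Inductive gate_label (X gate : Type) :=
| LVar of X
| LZero
| LMax of gate & gate
| LPlus of gate & gate.
Arguments LZero {X gate}.

Definition is_input (X : Type) (gate : eqType)
    (label : gate -> gate_label X gate) : rel gate :=
  fun g h => match label g with
             | LVar _ | LZero => false
             | LMax h1 h2 | LPlus h1 h2 => (h == h1) || (h == h2)
             end.

Record circuit (X : Type) := Circuit {
  gate : finType;
  label : gate -> gate_label X gate;
  output : gate;
  circuit_acyclic : forall c : seq gate, cycle (is_input label) c -> c = [::]
}.

Definition num_gates (X : Type) (C : circuit X) : nat := #|gate C|.

Inductive computes (X : choiceType) (C : circuit X) :
    gate C -> {mset X} -> Prop :=
| computes_var g x : label g = LVar _ x -> computes g [mset x]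
| computes_zero g : label g = LZero -> computes g mset0
| computes_maxl g h1 h2 m :
    label g = LMax _ h1 h2 -> computes h1 m -> computes g m
| computes_maxr g h1 h2 m :
    label g = LMax _ h1 h2 -> computes h2 m -> computes g m
| computes_plus g h1 h2 m1 m2 :
    label g = LPlus _ h1 h2 -> computes h1 m1 -> computes h2 m2 ->
    computes g (m1 `+` m2).

Definition mset_of_set (V : finType) (S : {set V}) : {mset V} :=
  seq_mset (enum S).

Definition is_MWIS_polynomial (G : sgraph) (f : {mset G} -> Prop) : Prop :=
  (forall m, f m -> exists2 S : {set G}, independent S & m = mset_of_set S) /\
  (forall S : {set G}, independent S -> f (mset_of_set S)).

Definition is_MWIS_circuit (G : sgraph) (C : circuit G) : Prop :=
  is_MWIS_polynomial (@computes G C (output C)).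

(* Main.v *)
Require Import Defs.
From mathcomp Require Import all_boot all_order all_algebra.
From mathcomp Require Import finmap multiset zify ring lra.
From mathcomp Require Import boolp reals exp.

(** A gate [h] together with the part of the circuit outside it yields disjoint,
    non-adjacent vertex sets [A] and [B]: the vertices occurring in monomials of
    [h], and those occurring in its contexts. Large treewidth provides a set
    [W] of about [w / 2] vertices such that every such pair splitting [W]
    in a balanced way leaves at least [#|W| / 3] vertices uncovered.
    Following the parse tree of the monomial of an independent set [I]
    down to a balanced pair, we find that [I] avoids one of at most [s ^ 2]
    separators, where [s] is the number of gates. On the other hand, under the
    hard-core measure of fugacity [1 / (2 d)], a separator of size [k] is
    avoided with probability at most [(1 + 1 / (4 d)) ^- k]; hence
    [s ^ 2 >= 2 `^ (w / (24 d))]. *)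

Set Implicit Arguments.
Unset Strict Implicit.
Unset Printing Implicit Defensive.
Import Order.TTheory GRing.Theory Num.Theory.
Local Open Scope nat_scope.

(** * Trees given by a parent function and a rank *)

Section RootedTree.
Variables (T : finType) (root : T) (parent : T -> T) (rank : T -> nat).
Hypothesis rank_parent : forall x, x != root -> rank (parent x) < rank x.

Definition rooted_adj : rel T :=
  [rel x y | ((x != root) && (parent x == y)) ||
             ((y != root) && (parent y == x))].

Lemma rooted_adj_sym : symmetric rooted_adj.
Proof. by move=> x y; rewrite /rooted_adj /= orbC. Qed.

Lemma rooted_adj_irrefl : irreflexive rooted_adj.
Proof.
move=> x; rewrite /rooted_adj /= orbb; apply/negP.
move=> /andP[/rank_parent + /eqP pxx].
by rewrite pxx ltnn.
Qed.

Definition rooted_sgraph : sgraph := SGraph rooted_adj_sym rooted_adj_irrefl.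

(** Climbing to the parent stays in [P] and lowers the rank, so the climb ends, and it can end only
    at [t]. *)
Lemma rooted_connect_in (P : pred T) (t : T) :
  (forall x, P x -> x != t -> (x != root) && P (parent x)) ->
  forall x, P x -> connect [rel a b | [&& rooted_adj a b, P a & P b]] x t.
Proof.
move=> Pup x; have [n] := ubnP (rank x); elim: n x => // n IHn x lt_xn Px.
have [->|xt] := eqVneq x t; first exact: connect0.
have /andP[xr Ppx] := Pup x Px xt.
apply: connect_trans (IHn (parent x) _ Ppx).
  by apply: connect1; rewrite /rooted_adj /= xr eqxx Px Ppx.
by rewrite -ltnS (leq_trans _ lt_xn) // ltnS rank_parent.
Qed.

Lemma rooted_connect_in2 (P : pred T) (t : T) :
  (forall x, P x -> x != t -> (x != root) && P (parent x)) ->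
  forall x y, P x -> P y ->
    connect [rel a b | [&& rooted_adj a b, P a & P b]] x y.
Proof.
move=> Pup x y Px Py; apply: connect_trans (rooted_connect_in Pup Px) _.
rewrite sym_connect_sym; first exact: rooted_connect_in Pup _ Py.
by move=> a b /=; rewrite rooted_adj_sym [P a && _]andbC.
Qed.

(* The two neighbours on a cycle of a vertex of maximal rank are its parent. *)
Lemma rooted_is_tree : is_tree rooted_sgraph.
Proof.
split.
- by apply/card_gt0P; exists root.
- move=> s t.
  have up x : predT x -> x != root -> (x != root) && predT (parent x).
    by move=> _ ->.
  have conn := rooted_connect_in2 up (isT : predT s) (isT : predT t).
  apply: (connect_sub _ conn).
  by move=> x y /andP[xy _]; exact: connect1.
- move=> c /andP[cyc_c uniq_c]; rewrite leqNgt; apply/negP => size_c.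
  have [x0 x0c] : exists x0, x0 \in c.
    by case: c size_c {cyc_c uniq_c} => // a c _; exists a; rewrite mem_head.
  case: (@arg_maxnP _ x0 (mem c) rank x0c) => x xc xmax.
  have [i c' rot_c] := rot_to xc.
  move: cyc_c uniq_c size_c; rewrite -(rot_cycle i) -(rot_uniq i) -(size_rot i).
  have {}xmax y : y \in x :: c' -> rank y <= rank x.
    by rewrite -rot_c mem_rot => /xmax.
  have up y : y \in x :: c' -> rooted_adj x y -> parent x = y.
    move=> yc /orP[/andP[_ /eqP//]|/andP[/rank_parent + /eqP pyx]].
    by rewrite pyx ltnNge xmax.
  rewrite rot_c; case: c' {rot_c i xc} xmax up => [|y [|z c']] //= xmax up.
  rewrite rcons_path => /andP[xy /andP[_ /andP[_ lx]]] /and3P[_ yzc _] _.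
  have pxy : parent x = y by apply: up => //; rewrite !inE eqxx orbT.
  have pxl : parent x = last z c'.
    apply: up; first by rewrite 2!in_cons mem_last !orbT.
    by rewrite rooted_adj_sym.
  by move: yzc; rewrite -pxy pxl mem_last.
Qed.

End RootedTree.

(** * Tree decompositions from small balanced separators *)

Section BalancedSeparators.
Variable G : sgraph.
Implicit Types A B U W : {set G}.

Definition nonadjacent A B := forall u v, u \in A -> v \in B -> ~~ adj u v.

(** A tree decomposition of the subgraph induced by [U]. Connectedness takes the form of a topmost
    bag for each vertex ([rd_top]), which is easy to maintain when trees are glued under a new
    root. *)
Record rooted_decomposition (U W : {set G}) (k : nat) := RootedDecomposition {
  rd_node : finType;
  rd_root : rd_node;
  rd_parent : rd_node -> rd_node;
  rd_rank : rd_node -> nat;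
  rd_bag : rd_node -> {set G};
  rd_rankP : forall x, x != rd_root -> rd_rank (rd_parent x) < rd_rank x;
  rd_bag_sub : forall x, rd_bag x \subset U;
  rd_bag_card : forall x, 3 * #|rd_bag x| < k;
  rd_edge : forall u v, u \in U -> v \in U -> adj u v ->
    exists t, (u \in rd_bag t) && (v \in rd_bag t);
  rd_root_bag : W \subset rd_bag rd_root;
  rd_top : forall v, v \in U -> exists2 t, v \in rd_bag t &
    forall x, v \in rd_bag x -> x != t ->
      (x != rd_root) && (v \in rd_bag (rd_parent x))
}.

Lemma rooted_decomposition_treewidth (k w : nat) :
  rooted_decomposition [set: G] set0 k -> is_treewidth G w ->
  3 * w < k.
Proof.
case=> T r p rk bag rkP _ bag_card edge _ top [_ tw_le].
have con (v : G) (s t : rooted_sgraph rkP) :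
    v \in bag s -> v \in bag t ->
    connect [rel a b : rooted_sgraph rkP |
               [&& adj a b, v \in bag a & v \in bag b]] s t.
  have [t0 _ up] := top v (in_setT v).
  exact: (rooted_connect_in2 rkP (P := [pred x | v \in bag x]) up).
have vtx (v : G) : exists t : rooted_sgraph rkP, v \in bag t.
  by have [t vt _] := top v (in_setT v); exists t.
have edg (u v : G) :
    adj u v -> exists t : rooted_sgraph rkP, (u \in bag t) && (v \in bag t).
  exact: edge (in_setT u) (in_setT v).
have := tw_le (TreeDecomposition (rooted_is_tree rkP) vtx edg con).
rewrite /td_width /=.
have : \max_(t : T) #|bag t| <= k.-1 %/ 3.
  by apply/bigmax_leqP => t _; have := bag_card t; lia.
have := bag_card r; lia.
Qed.

Lemma rooted_decomposition_leaf U W k :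
  3 * #|U| < k -> W \subset U -> rooted_decomposition U W k.
Proof.
move=> ltUk sWU.
apply: (@RootedDecomposition U W k unit tt id (fun _ => 0) (fun _ => U)) => //.
- by move=> u v uU vU _; exists tt; rewrite uU vU.
- by move=> v vU; exists tt => // -[].
Qed.

(** A new root [None] with bag [W] is placed above both trees. It is the topmost bag of the vertices
    of [W]; any other vertex lies in only one of [U1] and [U2] and keeps its old topmost bag. *)
Lemma rooted_decomposition_join U1 U2 W W1 W2 k :
  nonadjacent (U1 :\: U2) (U2 :\: U1) ->
  W \subset U1 :|: U2 -> 3 * #|W| < k ->
  U1 :&: U2 \subset W -> W :&: U1 \subset W1 -> W :&: U2 \subset W2 ->
  rooted_decomposition U1 W1 k -> rooted_decomposition U2 W2 k ->
  rooted_decomposition (U1 :|: U2) W k.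
Proof.
move=> nadj sWU ltWk sIW sW1 sW2.
case=> T1 r1 p1 rk1 bag1 rkP1 sub1 card1 edge1 root1 top1.
case=> T2 r2 p2 rk2 bag2 rkP2 sub2 card2 edge2 root2 top2.
pose p (x : option (T1 + T2)) : option (T1 + T2) := match x with
  | None => None
  | Some (inl y) => if y == r1 then None else Some (inl (p1 y))
  | Some (inr y) => if y == r2 then None else Some (inr (p2 y))
  end.
pose rk (x : option (T1 + T2)) := match x with
  | None => 0 | Some (inl y) => (rk1 y).+1 | Some (inr y) => (rk2 y).+1 end.
pose bag (x : option (T1 + T2)) := match x with
  | None => W | Some (inl y) => bag1 y | Some (inr y) => bag2 y end.
have in1 v x : v \in bag1 x -> v \in U1 by apply: subsetP; exact: sub1.
have in2 v x : v \in bag2 x -> v \in U2 by apply: subsetP; exact: sub2.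
have inr1 v : v \in W -> v \in U1 -> v \in bag1 r1.
  by move=> vW vU; apply: (subsetP root1); apply: (subsetP sW1); rewrite inE vW.
have inr2 v : v \in W -> v \in U2 -> v \in bag2 r2.
  by move=> vW vU; apply: (subsetP root2); apply: (subsetP sW2); rewrite inE vW.
have inW v : v \in U1 -> v \in U2 -> v \in W.
  by move=> v1 v2; apply: (subsetP sIW); rewrite inE v1.
apply: (@RootedDecomposition _ W k _ None p rk bag) => //.
- by case=> [[y|y]|] //= _; case: eqVneq => //= yr; rewrite ltnS ?rkP1 ?rkP2.
- case=> [[y|y]|] //=; [exact: subset_trans (sub1 y) (subsetUl _ _)|].
  exact: subset_trans (sub2 y) (subsetUr _ _).
- by case=> [[y|y]|] //=.
- move=> u v; rewrite !inE => uU vU uv.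
  have [/andP[u1 v1]|n1] := boolP ((u \in U1) && (v \in U1)).
    by have [t tP] := edge1 u v u1 v1 uv; exists (Some (inl t)).
  have [/andP[u2 v2]|n2] := boolP ((u \in U2) && (v \in U2)).
    by have [t tP] := edge2 u v u2 v2 uv; exists (Some (inr t)).
  have [u1|u1] := boolP (u \in U1).
    have := nadj u v; rewrite !inE uv.
    move: uU vU n1 n2; rewrite u1.
    by do 3!case: (_ \in _) => //=; move=> _ _ _ _ /(_ isT isT).
  have := nadj v u; rewrite !inE adj_sym uv.
  move: uU vU n1 n2; rewrite (negbTE u1).
  by do 3!case: (_ \in _) => //=; move=> _ _ _ _ /(_ isT isT).
- move=> v vU; have [vW|vW] := boolP (v \in W).
    exists None => // -[[y|y]|] //= vy _; case: eqVneq => //= yr.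
      have [t vt up] := top1 v (in1 _ _ vy).
      (* [v] also lies in the root bag of its tree, and a root cannot climb, so the root is the
         topmost bag. *)
      have tr : r1 = t.
        apply/eqP/negPn/negP => /(up _ (inr1 _ vW (in1 _ _ vy))).
        by rewrite eqxx.
      have /andP[] // : (y != r1) && (v \in bag1 (p1 y)).
      by apply: up; rewrite // -tr.
    have [t vt up] := top2 v (in2 _ _ vy).
    have tr : r2 = t.
      apply/eqP/negPn/negP => /(up _ (inr2 _ vW (in2 _ _ vy))).
      by rewrite eqxx.
    have /andP[] // : (y != r2) && (v \in bag2 (p2 y)).
    by apply: up; rewrite // -tr.
  have [v1|v1] := boolP (v \in U1).
    have [t vt up] := top1 v v1; exists (Some (inl t)) => // -[[y|y]|] //= vy.
    + move=> yt; have /andP[yr vp] : (y != r1) && (v \in bag1 (p1 y)).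
        by apply: up => //; apply: contraNN yt => /eqP->.
      by rewrite (negbTE yr).
    + by rewrite inW ?(in2 _ _ vy) in vW.
    + by rewrite vy in vW.
  have v2 : v \in U2 by move: vU; rewrite inE (negbTE v1).
  have [t vt up] := top2 v v2; exists (Some (inr t)) => // -[[y|y]|] //= vy.
  + by rewrite inW ?(in1 _ _ vy) in vW.
  + move=> yt; have /andP[yr vp] : (y != r2) && (v \in bag2 (p2 y)).
        by apply: up => //; apply: contraNN yt => /eqP->.
    by rewrite (negbTE yr).
  + by rewrite vy in vW.
Qed.

Definition balanced_separation W A B :=
  [/\ [disjoint A & B], nonadjacent A B, 3 * #|A :&: W| <= 2 * #|W|
    & 3 * #|B :&: W| <= 2 * #|W|].

Lemma subset_extend U W m : W \subset U -> #|W| <= m <= #|U| ->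
  exists W', [/\ W \subset W', W' \subset U & #|W'| = m].
Proof.
move=> sWU /andP[leWm lemU].
elim: m leWm lemU => [|m IHm]; first by rewrite leqn0 => /eqP W0; exists W.
rewrite leq_eqVlt ltnS => /predU1P[<- _|leWm ltmU]; first by exists W.
have [W' [sWW' sW'U cW']] := IHm leWm (ltnW ltmU).
have /subsetPn[x xU xW'] : ~~ (U \subset W').
  by apply: contraL ltmU => /subset_leq_card; rewrite cW' -leqNgt.
exists (x |: W'); split; last by rewrite cardsU1 xW' cW'.
  exact: subset_trans sWW' (subsetUr _ _).
by rewrite subUset sub1set xU.
Qed.

(** Robertson and Seymour's recursion: enlarge [W] to a set [W'] of exactly [m] vertices, separate
    it, and recurse on both sides. Each side must hold in its root bag its part of [W'] and the
    separator, at most [2 * m / 3 + m / 3] vertices. *)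
Lemma separators_rooted_decomposition m :
  (forall W, #|W| = m ->
    exists A B, balanced_separation W A B /\ 3 * #|~: (A :|: B)| < m) ->
  forall U W, W \subset U -> #|W| <= m -> 0 < m ->
  inhabited (rooted_decomposition U W (4 * m)).
Proof.
move=> sep U; have [n] := ubnP #|U|.
elim: n U => // n IHn U ltUn W sWU leWm m_gt0.
have [leUm|ltmU] := leqP #|U| m.
  by split; apply: rooted_decomposition_leaf => //; lia.
have [W' [sWW' sW'U cW']] :
    exists W', [/\ W \subset W', W' \subset U & #|W'| = m].
  by apply: subset_extend; rewrite // leWm ltnW.
have [A [B [[dAB nAB leA leB] ltS]]] := sep W' cW'.
set S := ~: (A :|: B) in ltS.
have cover : U = (U :&: ~: B) :|: (U :&: ~: A).
  apply/setP => x; rewrite !inE -andb_orr.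
  by case xA: (x \in A); rewrite ?(disjointFr dAB xA) ?orbT ?andbT.
have cW : #|W'| <= #|A :&: W'| + #|B :&: W'| + #|S|.
  have sub : W' \subset (A :&: W') :|: (B :&: W') :|: S.
    apply/subsetP => x xW; rewrite !inE xW !andbT.
    by case: (_ \in A); case: (_ \in B).
  apply: leq_trans (subset_leq_card sub) _.
  apply: leq_trans (leq_card_setU _ _) _.
  by rewrite leq_add2r leq_card_setU.
(* One side and the separator together hold fewer than [m] vertices of [W'], so the other side meets
   [W'] and deleting it makes [U] smaller. *)
have shrink X : 0 < #|X :&: W'| -> #|U :&: ~: X| < #|U|.
  move=> /card_gt0P[x]; rewrite inE => /andP[xX xW].
  apply: proper_card; apply/properP; split; first exact: subsetIl.
  by exists x; rewrite ?(subsetP sW'U) // !inE xX andbF.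
have part X : 3 * #|X :&: W'| <= 2 * #|W'| -> #|(X :&: W') :|: (S :&: U)| <= m.
  move=> leX; apply: leq_trans (leq_card_setU _ _) _.
  have := subset_leq_card (subsetIl S U); lia.
have [D1] : inhabited (rooted_decomposition
    (U :&: ~: B) ((A :&: W') :|: (S :&: U)) (4 * m)).
  apply: IHn; rewrite ?part //.
    by apply: leq_trans (shrink B _) ltUn; lia.
  apply/subsetP => x; rewrite !inE => /orP[/andP[xA xW]|/andP[]].
    by rewrite (subsetP sW'U _ xW) (disjointFr dAB xA).
  by rewrite negb_or => /andP[_ ->] ->.
have [D2] : inhabited (rooted_decomposition
    (U :&: ~: A) ((B :&: W') :|: (S :&: U)) (4 * m)).
  apply: IHn; rewrite ?part //.
    by apply: leq_trans (shrink A _) ltUn; lia.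
  apply/subsetP => x; rewrite !inE => /orP[/andP[xB xW]|/andP[]].
    by rewrite (subsetP sW'U _ xW) (disjointFl dAB xB).
  by rewrite negb_or => /andP[-> _] ->.
(* The new root bag has fewer than [m + m / 3] vertices: the source of [4 * m]. *)
have [D] : inhabited (rooted_decomposition U (W' :|: (S :&: U)) (4 * m)).
  split; rewrite {1}cover; apply: rooted_decomposition_join D1 D2.
  - move=> u v; rewrite !inE => /andP[uA /andP[uU uB]] /andP[vB /andP[vU vA]].
    apply: nAB; first by move: uA; rewrite uU /= negbK.
    by move: vB; rewrite vU /= negbK.
  - by rewrite -cover subUset sW'U subsetIr.
  - have := (leq_card_setU W' (S :&: U)).1.
    have := subset_leq_card (subsetIl S U); lia.
  - apply/subsetP => x; rewrite !inE => /andP[/andP[xU xB] /andP[_ xA]].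
    by rewrite xU negb_or xA xB orbT.
  - apply/subsetP => x; rewrite !inE => /andP[+ /andP[xU xB]].
    rewrite xU (negbTE xB) orbF !andbT.
    by case: (x \in A); rewrite ?orbT //= orbC.
  - apply/subsetP => x; rewrite !inE => /andP[+ /andP[xU xA]].
    rewrite xU (negbTE xA) /= !andbT.
    by case: (x \in B); rewrite ?orbT //= orbC.
case: D => T r p rk bag rkP sub card edge root top.
split; exists T r p rk bag => //.
exact: subset_trans sWW' (subset_trans (subsetUl _ _) root).
Qed.

(** Otherwise the recursion, started at [[set: G]] and [set0], would give bags of fewer than
    [4 * m / 3 <= w] vertices. *)
Lemma treewidth_unbreakable_set w m :
  is_treewidth G w -> 0 < m -> 4 * m <= 3 * w ->
  exists2 W : {set G}, #|W| = m &
    forall A B, balanced_separation W A B -> m <= 3 * #|~: (A :|: B)|.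
Proof.
move=> tw m_gt0 le_mw; apply: contrapT => noW.
have [||D] :=
  @separators_rooted_decomposition m _ [set: G] set0 (sub0set _) _ m_gt0.
- move=> W cW; apply: contrapT => noAB; apply: noW; exists W => // A B sep.
  by rewrite leqNgt; apply/negP => lt; apply: noAB; exists A, B.
- by rewrite cards0.
- by have := rooted_decomposition_treewidth D tw; rewrite ltnNge le_mw.
Qed.

End BalancedSeparators.

(** * Parse-tree contexts of a gate *)

Section Contexts.
Local Open Scope mset_scope.
Variables (X : choiceType) (C : circuit X).

(* [context g r] when some parse tree of the circuit has [g] as a node and [r]
   as the product of all its leaves that do not lie below that node. *)
Inductive context : gate C -> {mset X} -> Prop :=
| context_output : context (output C) mset0
| context_maxl g h1 h2 r :
    label g = LMax _ h1 h2 -> context g r -> context h1 r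
| context_maxr g h1 h2 r :
    label g = LMax _ h1 h2 -> context g r -> context h2 r
| context_plusl g h1 h2 r m :
    label g = LPlus _ h1 h2 -> context g r -> computes h2 m ->
    context h1 (r `+` m)
| context_plusr g h1 h2 r m :
    label g = LPlus _ h1 h2 -> context g r -> computes h1 m ->
    context h2 (r `+` m).

Lemma computes_context g r m :
  context g r -> computes g m -> computes (output C) (r `+` m).
Proof.
move=> cr; elim: cr m => {g r} [|g h1 h2 r lab _ IH|g h1 h2 r lab _ IH
  |g h1 h2 r m' lab _ IH cm'|g h1 h2 r m' lab _ IH cm'] m cm.
- by rewrite mset0D.
- exact: IH (computes_maxl lab cm).
- exact: IH (computes_maxr lab cm).
- rewrite -msetDA [m' `+` m]msetDC; apply: IH.
  exact: computes_plus lab cm cm'.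
- by rewrite -msetDA; apply: IH; exact: computes_plus lab cm' cm.
Qed.

End Contexts.

(** * From an independent set to a balanced separation *)

Section Descent.
Local Open Scope mset_scope.
Variables (G : sgraph) (C : circuit G).
Hypothesis mwis : is_MWIS_circuit C.

Definition supp (f : {mset G} -> Prop) : {set G} :=
  [set v | `[< exists2 m, f m & v \in m >]].

Lemma in_supp (f : {mset G} -> Prop) m v : f m -> v \in m -> v \in supp f.
Proof. by move=> fm vm; rewrite inE; apply/asboolP; exists m. Qed.

Lemma suppP (f : {mset G} -> Prop) v :
  reflect (exists2 m, f m & v \in m) (v \in supp f).
Proof. by rewrite inE; exact: asboolP. Qed.

Local Notation gate_supp h := (supp (@computes G C h)).
Local Notation context_supp k := (supp (@context G C k)).

Lemma in_mset_of_set (S : {set G}) v : (v \in mset_of_set S) = (v \in S).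
Proof. by rewrite in_mset mset_seqE -has_count has_pred1 mem_enum. Qed.

Lemma mset_of_set_le1 (S : {set G}) v : mset_of_set S v <= 1.
Proof. by rewrite mset_seqE count_uniq_mem ?enum_uniq ?leq_b1. Qed.

(** Besides [k = h], this covers a [max] gate [k] with input [h], where the contexts of [k] are
    among those of [h]. *)
Definition rectangle (k h : gate C) := forall r m,
  context k r -> computes h m -> computes (output C) (r `+` m).

(** All products occur at the output, so they are square-free and independent: a shared vertex would
    have multiplicity two, and an edge across would lie inside an independent set. *)
Lemma rectangle_separated (k h : gate C) :
  rectangle k h -> [disjoint gate_supp h & context_supp k] /\
  nonadjacent (gate_supp h) (context_supp k).
Proof.
move=> rect; have [mon _] := mwis; split.
  apply/pred0P => v /=; apply/negP => /andP[/suppP[m cm vm] /suppP[r cr vr]].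
  have [S _ eqS] := mon _ (rect r m cr cm).
  have := mset_of_set_le1 S v; rewrite -eqS msetE2.
  by move: vm vr; rewrite !in_mset; lia.
move=> u v /suppP[m cm um] /suppP[r cr vr].
have [S indS eqS] := mon _ (rect r m cr cm).
by apply: indS; rewrite -in_mset_of_set -eqS in_msetD ?um ?vr ?orbT.
Qed.

Variable W : {set G}.
Hypothesis W_gt1 : 1 < #|W|.

Definition balanced_factorization (m : {mset G}) := exists k h,
  balanced_separation W (gate_supp h) (context_supp k) /\
  exists r m', [/\ context k r, computes h m' & m = r `+` m'].

(* The monomial is followed down its parse tree, into the heavier summand at a
   [+] gate, for as long as the gate still sees more than two thirds of [W]. *)
Lemma balanced_descent g m r :
  computes g m -> context g r ->
  2 * #|W| < 3 * #|gate_supp g :&: W| ->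
  balanced_factorization (r `+` m).
Proof.
move: g m r; have bound k h :
    rectangle k h -> #|gate_supp h :&: W| + #|context_supp k :&: W| <= #|W|.
  move=> /rectangle_separated[dis _]; rewrite -cardsUI -setIUl setIACA setIid.
  by rewrite (disjoint_setI0 dis) set0I cards0 addn0 subset_leq_card ?subsetIr.
(* The gate [h] may see very little of [W], and its own contexts too much. Those of [g] are used
   instead: they see less than one third, as [g] sees over two thirds. *)
have max_case g h r m :
    (forall r, context g r -> context h r) -> context g r -> computes h m ->
    2 * #|W| < 3 * #|gate_supp g :&: W| ->
    3 * #|gate_supp h :&: W| <= 2 * #|W| ->
    balanced_factorization (r `+` m).
  move=> gh cr cm big small; exists g, h; split; last by exists r, m.
  have [dis nadj] : [disjoint gate_supp h & context_supp g] /\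
      nonadjacent (gate_supp h) (context_supp g).
    by apply: rectangle_separated => r' m' /gh; exact: computes_context.
  have := bound g g (@computes_context _ _ g); split=> //; lia.
(* A gate seeing between one and two thirds of [W] is balanced against its own contexts. *)
have plus_case h r m : context h r -> computes h m ->
    #|W| <= 3 * #|gate_supp h :&: W| ->
    3 * #|gate_supp h :&: W| <= 2 * #|W| ->
    balanced_factorization (r `+` m).
  move=> cr cm big small; exists h, h; split; last by exists r, m.
  have [dis nadj] := rectangle_separated (@computes_context _ _ h).
  have := bound h h (@computes_context _ _ h); split=> //; lia.
move=> g m + cm; elim: cm => {g m}
  [g x lab|g lab|g h1 h2 m lab cm IH|g h1 h2 m lab cm IH
  |g h1 h2 m1 m2 lab cm1 IH1 cm2 IH2] r cr big.
(* A leaf sees at most one vertex, too few for [big] since [W] has at least two. *)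
- have sub : gate_supp g :&: W \subset [set x].
    apply/subsetP => v; rewrite in_setI => /andP[/suppP[m cm vm] _].
    rewrite inE.
    by case: cm vm lab => [? ? ->|? ->|? ? ? ? ->|? ? ? ? ->|? ? ? ? ? ->] //;
       rewrite in_mset1 => /eqP-> [->].
  by have := subset_leq_card sub; rewrite cards1; lia.
- have sub : gate_supp g :&: W \subset set0.
    apply/subsetP => v; rewrite in_setI => /andP[/suppP[m cm vm] _].
    rewrite inE.
    by case: cm vm lab => [? ? ->|? ->|? ? ? ? ->|? ? ? ? ->|? ? ? ? ? ->] //;
       rewrite in_mset0.
  by have := subset_leq_card sub; rewrite cards0; lia.
- have gh r' : context g r' -> context h1 r' by exact: context_maxl lab.
  have [small|big'] := leqP (3 * #|gate_supp h1 :&: W|) (2 * #|W|).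
    exact: max_case gh cr cm big small.
  exact: IH (gh r cr) big'.
- have gh r' : context g r' -> context h2 r' by exact: context_maxr lab.
  have [small|big'] := leqP (3 * #|gate_supp h2 :&: W|) (2 * #|W|).
    exact: max_case gh cr cm big small.
  exact: IH (gh r cr) big'.
have cr1 : context h1 (r `+` m2) by exact: context_plusl lab cr cm2.
have cr2 : context h2 (r `+` m1) by exact: context_plusr lab cr cm1.
have e1 : r `+` (m1 `+` m2) = (r `+` m2) `+` m1.
  by rewrite [m1 `+` m2]msetDC msetDA.
have e2 : r `+` (m1 `+` m2) = (r `+` m1) `+` m2 by rewrite msetDA.
have [small1|big1] := leqP (3 * #|gate_supp h1 :&: W|) (2 * #|W|);
  last by rewrite e1; exact: IH1.
have [small2|big2] := leqP (3 * #|gate_supp h2 :&: W|) (2 * #|W|);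
  last by rewrite e2; exact: IH2.
have sub : gate_supp g :&: W \subset
    (gate_supp h1 :&: W) :|: (gate_supp h2 :&: W).
  rewrite -setIUl setSI //; apply/subsetP => v /suppP[m cm vm]; rewrite in_setU.
  case: cm vm lab => [? ? ->|? ->|? ? ? ? ->|? ? ? ? ->|? ? ? ? ? -> ca cb] //.
  move=> + [<- <-]; rewrite in_msetD => /orP[va|vb].
    by rewrite (in_supp ca).
  by rewrite (in_supp cb) // orbT.
(* Together the summands see over two thirds of [W], so one sees at least one third. *)
have := leq_trans (subset_leq_card sub) (leq_card_setU _ _).
have [big1 _|lt1 le12] := leqP #|W| (3 * #|gate_supp h1 :&: W|).
  by rewrite e1; exact: plus_case cr1 cm1 big1 small1.
by rewrite e2; apply: plus_case cr2 cm2 _ small2; lia.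
Qed.

(** The balanced pair found for [I] covers [I], so [I] misses the complement. Indexing complements
    by pairs of gates gives the count [s ^ 2]. *)
Lemma independent_avoids_separator (m : nat) :
  (forall A B, balanced_separation W A B -> m <= 3 * #|~: (A :|: B)|) ->
  exists S : gate C * gate C -> {set G}, forall I : {set G}, independent I ->
    exists2 p, m <= 3 * #|S p| & [disjoint I & S p].
Proof.
move=> unbreak.
exists (fun p => ~: (gate_supp p.2 :|: context_supp p.1)) => I indI.
have [_ out] := mwis.
have big : 2 * #|W| < 3 * #|gate_supp (output C) :&: W|.
  rewrite (setIidPr _); first by lia.
  apply/subsetP => v _; apply: (@in_supp _ (mset_of_set [set v])).
    by apply: out => x y /set1P-> /set1P->; rewrite adj_irrefl.
  by rewrite in_mset_of_set set11.
have [k [h [sep [r [m' [cr cm eq_rm]]]]]] :=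
  balanced_descent (out I indI) (context_output C) big.
exists (k, h); first exact: unbreak.
rewrite disjoints_subset setCK; apply/subsetP => v.
rewrite -in_mset_of_set -[mset_of_set I]mset0D eq_rm in_msetD in_setU.
move=> /orP[vr|vm].
  by rewrite (in_supp cr) ?orbT.
by rewrite (in_supp cm).
Qed.

End Descent.

(** Serves the case of small treewidth. A lone gate is a leaf by acyclicity and computes one
    monomial, but both the empty monomial and [v] must occur. *)
Lemma mwis_circuit_num_gates (G : sgraph) (C : circuit G) (v : G) :
  is_MWIS_circuit C -> 1 < num_gates C.
Proof.
move=> [_ out]; rewrite ltnNge; apply/negP => /card_le1_eqP one.
have eqg (g : gate C) : g = output C by exact: one.
have leaf : forall h, ~~ is_input (@label _ C) (output C) h.
  move=> h; apply/negP; rewrite (eqg h) => loop.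
  by have := @circuit_acyclic _ C [:: output C]; rewrite /= loop => /(_ isT).
have c0 : computes (output C) (mset_of_set (set0 : {set G})).
  by apply: out => x y; rewrite inE.
have cv : computes (output C) (mset_of_set [set v]).
  by apply: out => x y /set1P-> /set1P->; rewrite adj_irrefl.
have val m : computes (output C) m -> match label (output C) with
    LVar x => m = [mset x]%mset | LZero => m = mset0%mset | _ => True end.
  by case=> [? ? ->|? ->|? ? ? ? ->|? ? ? ? ->|? ? ? ? ? ->].
have e : mset_of_set [set v] = mset_of_set (set0 : {set G}).
  move: (val _ c0) (val _ cv).
  case lab: (label (output C)) => [x||h1 h2|h1 h2]; try by move=> -> ->.
  - by have := leaf h1; rewrite /is_input lab eqxx.
  - by have := leaf h1; rewrite /is_input lab eqxx.
by have := in_mset_of_set [set v] v; rewrite e in_mset_of_set !inE eqxx.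
Qed.

Local Open Scope ring_scope.

(** * The hard-core measure on independent sets *)

Section HardCore.
Variables (R : realFieldType) (G : sgraph) (lambda : R).
Hypothesis lambda_ge0 : 0 <= lambda.
Implicit Types X Y S I J : {set G}.

Definition closed_nbhd (v : G) : {set G} := v |: [set u | adj v u].

(** The independence polynomial of the subgraph induced by [X], that is, the partition function of
    the hard-core model. *)
Definition hard_core (X : {set G}) : R :=
  \sum_(I : {set G} | (I \subset X) && `[< independent I >]) lambda ^+ #|I|.

Lemma hard_core_gt0 X : 0 < hard_core X.
Proof.
rewrite /hard_core (bigD1 set0) /=; last first.
  by rewrite sub0set; apply/asboolP => u v; rewrite inE.
by rewrite cards0 expr0 ltr_pwDl // sumr_ge0 // => I _; rewrite exprn_ge0.
Qed.

Lemma hard_core_mono X Y : X \subset Y -> hard_core X <= hard_core Y.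
Proof.
move=> sXY; rewrite /hard_core.
rewrite [leRHS](bigID (fun I : {set G} => I \subset X)) /=.
rewrite ler_wpDr ?sumr_ge0 // => [I _|]; first by rewrite exprn_ge0.
rewrite le_eqVlt; apply/orP; left; apply/eqP; apply: eq_bigl => I.
by case: (boolP (I \subset X)) => [/subset_trans->|]; rewrite ?andbF ?andbT.
Qed.

Lemma independentU1 (v : G) J : v \notin J ->
  independent (v |: J) <-> independent J /\ [disjoint J & [set u | adj v u]].
Proof.
move=> vJ; split=> [ind|[ind dis] x y].
  split=> [x y xJ yJ|]; first by apply: ind; rewrite !inE ?xJ ?yJ orbT.
  apply/pred0P => x /=; apply/negP => /andP[xJ]; rewrite inE.
  by apply/negP/ind; rewrite !inE ?eqxx // xJ orbT.
rewrite !inE => /predU1P[->|xJ] /predU1P[->|yJ].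
- by rewrite adj_irrefl.
- by have := disjointFr dis yJ; rewrite inE => ->.
- by have := disjointFr dis xJ; rewrite inE adj_sym => ->.
- exact: ind.
Qed.

Lemma hard_core_rec (v : G) X : v \in X ->
  hard_core X = hard_core (X :\ v) + lambda * hard_core (X :\: closed_nbhd v).
Proof.
move=> vX; rewrite {1}/hard_core (bigID (fun I : {set G} => v \in I)) /= addrC.
congr (_ + _).
  apply: eq_bigl => I; rewrite subsetD1.
  by case: (_ \subset _); rewrite ?andbF //= andbC.
rewrite (reindex_onto (fun J => v |: J) (fun I => I :\ v)) /=; last first.
  by move=> I /andP[_ vI]; rewrite setD1K.
rewrite mulr_sumr; apply: eq_big => [J|J].
  rewrite setU11 andbT; have [vJ|vJ] := boolP (v \in J).
    have -> : (v |: J) :\ v == J = false.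
      by apply/negbTE/eqP => /setP/(_ v); rewrite !inE eqxx vJ.
    rewrite andbF; apply/esym/negbTE/negP => /andP[/subsetP/(_ v vJ)].
    by rewrite !inE eqxx.
  rewrite setU1K // eqxx andbT subUset sub1set vX /= subsetD -andbA.
  congr (_ && _).
  have -> : [disjoint J & closed_nbhd v] = [disjoint J & [set u | adj v u]].
    rewrite ![[disjoint J & _]]disjoint_sym /closed_nbhd.
    rewrite -!setI_eq0 setIUl.
    have -> : [set v] :&: J = set0 by apply/eqP; rewrite setI_eq0 disjoints1.
    by rewrite set0U.
  apply/asboolP/andP => [/(independentU1 vJ)[ind dis]|[dis /asboolP ind]].
    by split=> //; apply/asboolP.
  exact/(independentU1 vJ).
move=> /andP[_ /eqP eqJ]; rewrite cardsU1.
by have -> : v \notin J; rewrite ?add1n ?exprS // -eqJ !inE eqxx.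
Qed.

Lemma hard_core_leD (v : G) X :
  hard_core X <= (1 + lambda) * hard_core (X :\ v).
Proof.
have [vX|vX] := boolP (v \in X); last first.
  have -> : X :\ v = X.
    apply/setP => x; rewrite !inE.
    by case: eqVneq => // ->; rewrite (negbTE vX).
  by rewrite ler_peMl ?lerDl // ltW ?hard_core_gt0.
rewrite (hard_core_rec vX) mulrDl mul1r lerD2l ler_wpM2l // hard_core_mono //.
by rewrite setDS // sub1set !inE eqxx.
Qed.

Lemma hard_core_leD_set S X :
  hard_core X <= (1 + lambda) ^+ #|S| * hard_core (X :\: S).
Proof.
have [n] := ubnP #|S|; elim: n S X => // n IHn S X; rewrite ltnS => leSn.
have [->|[v vS]] := set_0Vmem S; first by rewrite cards0 expr0 mul1r setD0.
rewrite (cardsD1 v) vS exprS -mulrA.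
apply: le_trans (hard_core_leD v X) _; rewrite ler_wpM2l ?addr_ge0 //.
have -> : X :\: S = (X :\ v) :\: (S :\ v).
  by apply/setP => x; rewrite !inE; case: eqVneq => [->|]; rewrite ?vS.
by apply: IHn; apply: leq_trans leSn; rewrite [leqRHS](cardsD1 v) vS.
Qed.

Variable q : R.
Hypothesis q_ge0 : 0 <= q.
Hypothesis q_le : q * (1 + lambda) ^+ max_degree G <= lambda.

(** Deleting the neighbours of [v] costs a factor of at most [(1 + lambda) ^+ max_degree G], so by
    [q_le] the second term of the recurrence is at least [q] times the first. *)
Lemma hard_core_geD (v : G) X : v \in X ->
  (1 + q) * hard_core (X :\ v) <= hard_core X.
Proof.
move=> vX; rewrite (hard_core_rec vX) mulrDl mul1r lerD2l.
have step := hard_core_leD_set [set u | adj v u] (X :\ v).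
have eqD : (X :\ v) :\: [set u | adj v u] = X :\: closed_nbhd v.
  by rewrite setDDl.
rewrite eqD in step.
apply: le_trans (ler_wpM2l q_ge0 step) _.
rewrite mulrA ler_wpM2r ?(ltW (hard_core_gt0 _)) //.
apply: le_trans _ q_le; rewrite ler_wpM2l // ler_weXn2l ?lerDl //.
exact: (@leq_bigmax _ (@degree G)).
Qed.

Lemma hard_core_geD_set S X : S \subset X ->
  (1 + q) ^+ #|S| * hard_core (X :\: S) <= hard_core X.
Proof.
have [n] := ubnP #|S|; elim: n S X => // n IHn S X; rewrite ltnS => leSn sSX.
have [->|[v vS]] := set_0Vmem S; first by rewrite cards0 expr0 mul1r setD0.
rewrite (cardsD1 v) vS exprS -mulrA.
apply: le_trans _ (hard_core_geD (subsetP sSX v vS)).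
rewrite ler_wpM2l ?addr_ge0 //.
have -> : X :\: S = (X :\ v) :\: (S :\ v).
  by apply/setP => x; rewrite !inE; case: eqVneq => [->|]; rewrite ?vS.
apply: IHn; last by rewrite setSD.
by apply: leq_trans leSn; rewrite [leqRHS](cardsD1 v) vS.
Qed.

(* Weighting independent sets by the hard-core measure, those avoiding a given
   [S] have total weight at most [(1 + q) ^- #|S|]. *)
Lemma avoiding_family_card (P : finType) (S : P -> {set G}) (b : R) :
  0 <= b ->
  (forall I, independent I ->
     exists2 p, b <= (1 + q) ^+ #|S p| & [disjoint I & S p]) ->
  b <= #|P|%:R.
Proof.
move=> b_ge0 avoid.
have Z_gt0 := hard_core_gt0 [set: G].
rewrite -(ler_pM2r Z_gt0).
(* A union bound: each independent set is counted at some sufficiently large separator that it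
   avoids. *)
have cover : hard_core [set: G] <=
    \sum_(p | b <= (1 + q) ^+ #|S p|) hard_core ([set: G] :\: S p).
  rewrite /hard_core.
  rewrite (exchange_big_dep
    (fun I : {set G} => (I \subset setT) && `[< independent I >])) /=;
    last by move=> ? ? _ /andP[_ ->]; rewrite subsetT.
  apply: ler_sum => I /andP[_ /asboolP indI].
  have [p bp dis] := avoid I indI.
  rewrite (bigD1 p) /=; last first.
    by rewrite bp subsetD subsetT dis /=; apply/asboolP.
  by rewrite lerDl sumr_ge0 // => ? _; rewrite exprn_ge0.
apply: le_trans (ler_wpM2l b_ge0 cover) _; rewrite mulr_sumr.
rewrite -sum1_card natr_sum mulr_suml big_mkcond /=.
apply: ler_sum => p _; case: ifP => bp; last by rewrite mul1r ltW.
rewrite mul1r; apply: le_trans _ (hard_core_geD_set (subsetT (S p))).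
by rewrite ler_wpM2r // ltW // hard_core_gt0.
Qed.

End HardCore.

(** * Numerical estimates and the final count *)

Lemma bernoulli (R : realFieldType) (x : R) n :
  -1 <= x -> 1 + x *+ n <= (1 + x) ^+ n.
Proof.
move=> x_ge; elim: n => [|n IHn]; first by rewrite mulr0n addr0 expr0.
have x1_ge0 : 0 <= 1 + x by lra.
rewrite exprS; apply: le_trans _ (ler_wpM2l x1_ge0 IHn).
have xxn : 0 <= x * x *+ n by rewrite mulrn_wge0 // -expr2 sqr_ge0.
rewrite mulrS mulrDl mul1r mulrDr mulr1 mulrnAr; lra.
Qed.

(** As [lambda = 2 * q], it suffices that [(1 + lambda) ^+ d <= 2]. Bernoulli bounds
    [(1 - lambda) ^+ d] below by [1 / 2], and its product with [(1 + lambda) ^+ d] is at most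
    one. *)
Lemma hard_core_rate (R : realFieldType) (d : nat) : (0 < d)%N ->
  (4 * d%:R)^-1 * (1 + (2 * d%:R)^-1) ^+ d <= (2 * d%:R)^-1 :> R.
Proof.
move=> d_gt0; set q := (4 * _)^-1; set lambda := (2 * _)^-1.
have dR : 1 <= d%:R :> R by rewrite ler1n.
have l_gt0 : 0 < lambda by rewrite invr_gt0; lra.
have l_le1 : lambda <= 1 by rewrite invf_le1; lra.
have ld : lambda *+ d = 2^-1 by rewrite -mulr_natr /lambda; field; lra.
have half : 2^-1 <= (1 - lambda) ^+ d.
  by apply: le_trans (bernoulli d _); [rewrite mulNrn ld|]; lra.
have prod1 : (1 + lambda) ^+ d * (1 - lambda) ^+ d <= 1.
  rewrite -exprMn exprn_ile1 //; first by apply: mulr_ge0; lra.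
  have := sqr_ge0 lambda; rewrite expr2; lra.
have le2 : (1 + lambda) ^+ d <= 2.
  have p_ge0 : 0 <= (1 + lambda) ^+ d by rewrite exprn_ge0; lra.
  have := ler_wpM2l p_ge0 half; lra.
have lq : lambda = q * 2 by rewrite /lambda /q; field; lra.
by rewrite [leRHS]lq ler_wpM2l // invr_ge0; lra.
Qed.

(** Bernoulli gives [2 <= (1 + q) ^+ (4 * d)]; raising to the power [q] yields [root], and then
    [q * k = 6 * k / (24 * d)]. *)
Lemma powR2_le_rate (R : realType) (d k w : nat) :
  (0 < d)%N -> (w <= 6 * k)%N ->
  2 `^ (w%:R / (24 * d%:R)) <= (1 + (4 * d%:R)^-1) ^+ k :> R.
Proof.
move=> d_gt0 le_wk; set q := (4 * d%:R)^-1 : R.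
have dR : 1 <= d%:R :> R by rewrite ler1n.
have q_gt0 : 0 < q by rewrite invr_gt0; lra.
have two : 2 <= (1 + q) `^ (4 * d%:R).
  rewrite -natrM powR_mulrn; last by lra.
  apply: le_trans (bernoulli _ _); last by lra.
  have -> : q *+ (4 * d) = 1 by rewrite -mulr_natr natrM /q mulVf //; lra.
  lra.
have root : 2 `^ q <= 1 + q.
  apply: le_trans (ge0_ler_powR (ltW q_gt0) _ _ two) _.
    by rewrite ?nnegrE.
    by rewrite ?nnegrE powR_ge0.
  have -> : (1 + q) `^ (4 * d%:R) `^ q = (1 + q) `^ 1.
    by rewrite -powRrM mulfV //; lra.
  by rewrite powRr1 //; lra.
apply: (@le_trans _ _ ((2 `^ q) ^+ k)); last first.
  by rewrite lerXn2r ?nnegrE ?powR_ge0 //; lra.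
rewrite -powR_mulrn ?powR_ge0 // -powRrM ler_powR //; first lra.
have -> : q * k%:R = (6 * k)%:R / (24 * d%:R) by rewrite natrM /q; field; lra.
by rewrite ler_wpM2r ?ler_nat // invr_ge0; lra.
Qed.

Theorem theorem1 (R : realType) :
  exists c : R, 0 < c /\
    forall (G : sgraph) (w d : nat),
      is_treewidth G w -> max_degree G = d -> (1 <= d)%N ->
      forall C : circuit G, is_MWIS_circuit C ->
        2 `^ (c * w%:R / d%:R) <= (num_gates C)%:R.
Proof.
(* [48 = 2 * 6 * 4]: the square of the number of gates is bounded, separators have at least [w / 6]
   vertices, and [q = 1 / (4 * d)]. *)
exists 48^-1; split=> [|G w d tw degG d_gt0 C mwis]; first by rewrite invr_gt0.
have dR : 1 <= d%:R :> R by rewrite ler1n.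
have sqr_powR :
    (2 `^ (48^-1 * w%:R / d%:R)) ^+ 2 = 2 `^ (w%:R / (24 * d%:R)) :> R.
  rewrite -powR_mulrn ?powR_ge0 // -powRrM.
  have -> // : 48^-1 * w%:R / d%:R * 2%:R = w%:R / (24 * d%:R) :> R.
  by field; rewrite pnatr_eq0 -lt0n.
(* For [w <= 2] the set [W] would have at most one vertex; but then the exponent is at most one, and
   two gates suffice. *)
have [w_le2|w_gt2] := leqP w 2.
  have [v _] : exists v : G, true.
    apply: contrapT => noG; move: d_gt0.
    rewrite -degG /max_degree big_pred0 // => v.
    by case: noG; exists v.
  apply: (@le_trans _ _ 2); last by rewrite ler_nat (mwis_circuit_num_gates v).
  rewrite -[leRHS]powRr1 // ler_powR //; first lra.
  have wR : w%:R <= 2 :> R by rewrite ler_nat.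
  rewrite ler_pdivrMr; lra.
(* Rounding up keeps [4 * uphalf w <= 2 * w + 2 <= 3 * w], and ensures
   [w <= 2 * uphalf w <= 6 * #|S p|] below. *)
have [||W cardW unbreak] := @treewidth_unbreakable_set G w (uphalf w) tw;
  [lia|lia|].
have W_gt1 : (1 < #|W|)%N by rewrite cardW; lia.
have [S avoid] := independent_avoids_separator mwis W_gt1 unbreak.
have l_ge0 : 0 <= (2 * d%:R)^-1 :> R by rewrite invr_ge0; lra.
have q_ge0 : 0 <= (4 * d%:R)^-1 :> R by rewrite invr_ge0; lra.
have rate := hard_core_rate R d_gt0; rewrite -{3}degG in rate.
have := @avoiding_family_card R G _ l_ge0 _ q_ge0 rate _ S
  (2 `^ (w%:R / (24 * d%:R))) (powR_ge0 _ _).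
rewrite card_prod natrM -expr2 => bound.
rewrite -(@ler_pXn2r _ 2) ?nnegrE ?powR_ge0 // sqr_powR.
apply: bound => I /avoid[p le_mS dis]; exists p => //.
by apply: powR2_le_rate => //; lia.
Qed.
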